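(* Let $\Gamma$ be an infinite Abelian torsion group and let $T$ be a tree of diameter $4$ with central vertex $v_c$. Then $T$ is $\Gamma$-vertex magic if and only if $T$ satisfies one of the following: (i) every non-pendant vertex of $T$ is in $\Omega_{\mathfrak{s}}(T)$; (ii) $v_c\in \Omega_{\mathfrak{w}}(T)$, $\deg(v_c)\not\equiv 2 \pmod{e(\Gamma)}$, and all other non-pendant vertices of $T$ are in $\Omega_{\mathfrak{s}}(T)$; (iii) $v_c\in \Omega_{\mathfrak{n}}(T)$ and $\gcd(\deg(v_c)-1,e(\Gamma))\neq 1$.
   Context: Graphs are finite, simple and undirected. For an additive Abelian group $\Gamma$ with identity $0$ and a graph $G$, a $\Gamma$-vertex magic labeling is a map $\ell:V(G)\to\Gamma\setminus\{0\}$ for which there is $\mu\in\Gamma$ (the magic constant) with $w(v)=\sum_{u\in N(v)}\ell(u)=\mu$ for every vertex $v$, where $N(v)$ is the open neighborhood; $G$ is $\Gamma$-vertex magic if it has such a labeling. A pendant vertex has degree $1$; a support vertex is a vertex adjacent to a pendant vertex. $\Omega_{\mathfrak{p}}(T)$ is the set of pendant vertices, $\Omega_{\mathfrak{s}}(T)$ the set of strong support vertices (adjacent to at least two pendant vertices), $\Omega_{\mathfrak{w}}(T)$ the set of weak support vertices (adjacent to exactly one pendant vertex), and $\Omega_{\mathfrak{n}}(T)$ the set of neutral vertices (neither pendant nor support). A tree of diameter $4$ has a unique central vertex $v_c$ (the middle vertex of every longest path). A torsion group is one in which every element has finite order. The exponent $e(\Gamma)$ is the least positive integer $n$ with $ng=0$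 for all $g\in\Gamma$, and $e(\Gamma)=\infty$ if no such $n$ exists.
   Formalization: When e(Γ)=∞, gcd(deg(v_c)−1, e(Γ)) is undefined (no value depending on the degree alone works: Z(2^∞), Z(3^∞), degree 3); it is read as the lcm of the orders of elements of Γ that divide deg(v_c)−1, which is the usual gcd when e(Γ) is finite. *)

(* Defs.v *)
From HB Require Import structures.
From mathcomp Require Import all_boot all_order all_algebra.
From mathcomp Require Import boolp classical_sets cardinality.

Set Implicit Arguments.
Unset Strict Implicit.
Unset Printing Implicit Defensive.

Import GRing.Theory.

(* Mathematical Components, with classical logic from mathcomp.classical. *)

Structure sgraph := SGraph {
  vertex :> finType;
  adj : rel vertex;
  adj_sym : symmetric adj;
  adj_irrefl : irreflexive adj }.

Section Graph.
Variable G : sgraph.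
Implicit Types (u v x y : G) (p c : seq G).

Definition nbh v : {set G} := [set u | adj v u].

Definition deg v : nat := #|nbh v|.

Definition connected_graph : Prop := forall x y, connect (@adj G) x y.

(* [ucycleb adj c] also accepts the empty sequence and, traversing an edge back
   and forth, two-element sequences: cycles of a graph have length >= 3. *)
Definition acyclic_graph : Prop :=
  forall c, 2 < size c -> ~~ ucycleb (@adj G) c.

Definition is_tree : Prop := connected_graph /\ acyclic_graph.

Definition walk_length x y (k : nat) : bool :=
  [exists p : k.-tuple G, path (@adj G) x p && (last x p == y)].

(* Two vertices joined by a walk are at distance < #|G|; the junk value #|G|
   is taken only in disconnected graphs. *)
Definition dist x y : nat := find (walk_length x y) (iota 0 #|G|).

Definition diameter : nat := \max_(x : G) \max_(y : G) dist x y.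

(* [x :: p] is the list of vertices of the path, [size p] is its length. *)
Definition simple_path x p : bool := path (@adj G) x p && uniq (x :: p).

Definition longest_path x p : Prop :=
  simple_path x p /\ forall y q, simple_path y q -> size q <= size p.

Definition middle x p : G := nth x (x :: p) (size p)./2.

Definition central_vertex v : Prop :=
  forall x p, longest_path x p -> middle x p = v.

Definition pendants : {set G} := [set v | deg v == 1].

Definition pendant_nbh v : {set G} := nbh v :&: pendants.

Definition supports : {set G} := [set v | 0 < #|pendant_nbh v|].

Definition strong_supports : {set G} := [set v | 1 < #|pendant_nbh v|].

Definition weak_supports : {set G} := [set v | #|pendant_nbh v| == 1].

Definition neutrals : {set G} := ~: (pendants :|: supports).

End Graph.

Definition vertex_magic (Gamma : zmodType) (G : sgraph) : Prop :=
  exists l : G -> Gamma, (forall v, l v <> 0%R) /\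
  exists mu : Gamma, forall v, (\sum_(u in nbh v) l u)%R = mu.

Section Exponent.
Variable Gamma : zmodType.
Implicit Types (g : Gamma) (n m d : nat).

Definition torsion : Prop :=
  forall g, exists n, 0 < n /\ (g *+ n = 0)%R.

Definition annihilator n : bool :=
  (0 < n) && `[< forall g, (g *+ n = 0)%R >].

(* [None] stands for the value infinity. *)
Definition exponent : option nat :=
  if pselect (exists n, annihilator n) is left ex_ann
  then Some (ex_minn ex_ann) else None.

Definition has_order g d : Prop :=
  0 < d /\ forall m, (g *+ m = 0)%R <-> d %| m.

(* The gcd of n > 0 and the (possibly infinite, in the sense of supernatural
   numbers) lcm of the orders of the elements of Gamma: the orders that divide
   n form the finite family whose lcm is taken here. *)
Definition gcd_orders n : nat :=
  \big[lcmn/1]_(d <- divisors n | `[< exists g, has_order g d >]) d.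

(* No value of gcd(n, oo) depending on n alone is adequate: Z(2^oo) and Z(3^oo)
   both have infinite exponent, but multiplication by 2 is injective only on
   the second. When the exponent is infinite, it is therefore read as the lcm
   of the orders of the elements, which it is also when finite (gcd_ordersE). *)
Definition gcd_exponent n : nat :=
  if exponent is Some e then gcdn n e else gcd_orders n.

(* Congruence modulo infinity is equality. *)
Definition eqmod_exponent n m : Prop :=
  if exponent is Some e then n = m %[mod e] else n = m.

Lemma exponentP e : exponent = Some e ->
  [/\ 0 < e, forall g, (g *+ e = 0)%R &
      forall n, 0 < n -> (forall g, (g *+ n = 0)%R) -> e <= n].
Proof.
rewrite /exponent; case: pselect => // ex [<-].
case: ex_minnP => m /andP[m0 /asboolP mA] mmin; split=> // n n0 nA.
by apply: mmin; rewrite /annihilator n0; apply/asboolP.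
Qed.

Lemma gcd_ordersE e n : exponent = Some e -> 0 < n -> gcd_orders n = gcdn n e.
Proof.
move=> /exponentP[e0 eA emin] n0; apply/eqP; rewrite eqn_dvd; apply/andP; split.
  rewrite /gcd_orders big_seq_cond; elim/big_ind: _ => // [x y|d].
    by rewrite dvdn_lcm => -> ->.
  rewrite -dvdn_divisors// => /andP[dn /asboolP[g [_ gd]]].
  by rewrite dvdn_gcd dn; apply/gd/eA.
have c0 : 0 < gcdn n e by rewrite gcdn_gt0 n0.
apply/dvdn_partP => // p pc.
have /[!mem_primes]/and3P[p_pr _ pdc] : p \in primes (gcdn n e) by [].
have p0 := prime_gt0 p_pr; have p1 := prime_gt1 p_pr.
set k := logn p (gcdn n e); have k0 : 0 < k by rewrite logn_gt0.
have pe : p %| e := dvdn_trans pdc (dvdn_gcdr n e).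
have qc : p ^ k %| gcdn n e by rewrite pfactor_dvdnn.
have qe : p ^ k %| e := dvdn_trans qc (dvdn_gcdr n e).
have qn : p ^ k %| n := dvdn_trans qc (dvdn_gcdl n e).
have [g gne] : exists g, (g *+ (e %/ p) <> 0)%R.
  apply/existsNP => all0.
  have := emin (e %/ p); rewrite divn_gt0// (dvdn_leq e0 pe) => /(_ isT all0).
  by rewrite leqNgt ltn_Pdiv.
have hq : (g *+ (e %/ p ^ k) *+ p ^ k = 0)%R by rewrite -mulrnA divnK// eA.
have ord_h : has_order (g *+ (e %/ p ^ k))%R (p ^ k).
  split=> [|m]; first by rewrite expn_gt0 p0.
  split=> [hm|/dvdnP[r ->]]; last first.
    by rewrite mulnC mulrnA hq mul0rn.
  have hg : (g *+ (e %/ p ^ k) *+ gcdn m (p ^ k) = 0)%R.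
    have [->|m0] := posnP m; first by rewrite gcd0n.
    case: (egcdnP (p ^ k) m0) => u v Euv _.
    have : (g *+ (e %/ p ^ k) *+ (u * m) = 0)%R by rewrite mulnC mulrnA hm mul0rn.
    rewrite Euv mulrnDr => <-.
    by rewrite mulnC mulrnA hq mul0rn add0r.
  have /(dvdn_pfactor _ _ p_pr)[j jk Ej] := dvdn_gcdr m (p ^ k).
  have [jk1|kj] := ltnP j k; last first.
    by have /eqP <- : j == k; [rewrite eqn_leq jk|rewrite -Ej dvdn_gcdl].
  case: gne; have -> : e %/ p = (e %/ p ^ k) * p ^ j * p ^ (k.-1 - j).
    have jk2 : j <= k.-1 by rewrite -ltnS prednK.
    rewrite -mulnA -expnD subnKC//.
    by apply/eqP; rewrite eq_sym eqn_div// -mulnA -expnSr prednK// divnK.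
  by rewrite mulrnA [X in (X *+ _)%R]mulrnA -Ej hg mul0rn.
rewrite p_part -/k /gcd_orders (big_rem (p ^ k)) -?dvdn_divisors//=.
rewrite (_ : `[< _ >] = true) ?dvdn_lcml//.
by apply/asboolP; exists (g *+ (e %/ p ^ k))%R.
Qed.

End Exponent.

(* Main.v *)
Require Import Defs.
From HB Require Import structures.
From mathcomp Require Import all_boot all_order all_algebra.
From mathcomp Require Import boolp classical_sets cardinality.

(* In a magic labeling the weight of a pendant vertex is the label of its
   support vertex, so that all support vertices carry the magic constant [mu].
   In a tree of diameter 4 every vertex is at distance at most 2 from [vc], and
   the nonpendant vertices other than [vc] are supports adjacent to [vc].
   If [vc] is neutral, its weight gives [(deg vc - 1) mu = 0]. If [vc] is a
   support, the pendant neighbors of any other support have labels of sum [0],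
   hence there are at least two of them; if moreover [vc] has a single pendant
   neighbor, its label is [- (deg vc - 2) mu].
   Conversely, the labels of the nonpendant vertices being chosen accordingly,
   those of the pendant vertices are found independently around each support,
   since in an infinite group every element is a sum of [k] nonzero elements
   for every [k >= 2], and every nonzero element is one for [k = 1]. *)

Set Implicit Arguments.
Unset Strict Implicit.
Unset Printing Implicit Defensive.

Import GRing.Theory.

(** * Multiples and sums of nonzero elements in an Abelian group *)

Section Multiples.
Variable Gamma : zmodType.
Implicit Types (g : Gamma) (n m d : nat).

(** For [m <= n], both sides say that [n - m] annihilates [Gamma]. A finite exponent divides every
    annihilator, the remainder being a smaller one; if the exponent is infinite, only [0]
    annihilates. *)
Lemma eqmod_exponentP n m :
  eqmod_exponent Gamma n m <-> forall g, (g *+ n = g *+ m)%R.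
Proof.
wlog mn : n m / m <= n.
  move=> H; case/orP: (leq_total m n) => [/H//|/H{}H].
  have -> : eqmod_exponent Gamma n m <-> eqmod_exponent Gamma m n.
    by rewrite /eqmod_exponent; case: exponent => [e|]; split=> ->.
  by rewrite H; split=> h g; rewrite h.
have subE g : (g *+ n = g *+ m)%R <-> (g *+ (n - m) = 0)%R.
  by rewrite mulrnBr//; split=> [->|/eqP]; rewrite ?subrr// subr_eq0 => /eqP.
rewrite /eqmod_exponent; case E: exponent => [e|]; last first.
  split=> [-> //|h]; apply/eqP; rewrite eqn_leq mn andbT leqNgt.
  apply/negP => lt_mn; move: E; rewrite /exponent; case: pselect => // -[].
  exists (n - m); rewrite /annihilator subn_gt0 lt_mn; apply/asboolP => g.
  exact/subE.
have [e0 eA emin] := exponentP E.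
have -> : (n = m %[mod e]) <-> e %| n - m.
  by rewrite -eqn_mod_dvd//; split=> [->|/eqP].
split=> [/dvdnP[k nmE] g|h].
  by apply/subE; rewrite nmE mulnC mulrnA eA mul0rn.
rewrite /dvdn; apply/negPn/negP; rewrite -lt0n => /emin emin_mod.
have := ltn_mod (n - m) e; rewrite e0 ltnNge emin_mod// => g.
have /subE := h g; rewrite {1}(divn_eq (n - m) e) mulrnDr mulnC mulrnA eA.
by rewrite mul0rn add0r.
Qed.

Lemma has_orderP g n : 0 < n -> (g *+ n = 0)%R -> exists d, has_order g d.
Proof.
move=> n0 gn; have ex : exists k, (0 < k) && (g *+ k == 0)%R.
  by exists n; rewrite n0 gn eqxx.
case: (ex_minnP ex) => d /andP[d0 /eqP gd] dmin; exists d; split=> // m.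
split=> [gm|/dvdnP[k ->]]; last by rewrite mulnC mulrnA gd mul0rn.
rewrite /dvdn; apply/negPn/negP; rewrite -lt0n => r0.
have := dmin (m %% d); rewrite r0 leqNgt ltn_mod d0 => H.
suff /H : (g *+ (m %% d) == 0)%R by [].
by move: gm; rewrite {1}(divn_eq m d) mulrnDr mulnC mulrnA gd mul0rn add0r => ->.
Qed.

(** [gcd_exponent] is, in both cases of its definition, the lcm of the element orders dividing [n];
    it differs from [1] as soon as one of these orders does. *)
Lemma gcd_exponent_neq1P n : 0 < n ->
  gcd_exponent Gamma n <> 1 <-> exists2 g : Gamma, (g <> 0)%R & (g *+ n = 0)%R.
Proof.
move=> n0; have -> : gcd_exponent Gamma n = gcd_orders Gamma n.
  by rewrite /gcd_exponent; case E: exponent => [e|//]; rewrite (gcd_ordersE E).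
split=> [neq1|[g g0 gn]].
  apply: contrapT => noG; apply: neq1; rewrite /gcd_orders big_seq_cond.
  rewrite big1// => d /andP[]; rewrite -dvdn_divisors// => dn.
  move=> /asboolP[g [_ gd]]; have gn : (g *+ n = 0)%R by apply/gd.
  have g0 : (g = 0)%R by apply: contrapT => g0; apply: noG; exists g.
  by apply/eqP; rewrite -dvdn1; apply/gd; rewrite g0 mul0rn.
have [d gd] := has_orderP n0 gn; have dn : d %| n by apply/gd.2.
rewrite /gcd_orders (big_rem d) -?dvdn_divisors//=.
rewrite (_ : `[< _ >] = true); last by apply/asboolP; exists g.
move=> l1; apply: g0; rewrite -[g]mulr1n; apply/gd.2.
by rewrite -[in X in _ %| X]l1 dvdn_lcml.
Qed.

Lemma infinite_avoid2 g1 g2 :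
  infinite_set [set: Gamma]%classic -> exists2 g, g <> g1 & g <> g2.
Proof.
move=> Ginf; apply: contrapT => H; apply: Ginf.
apply: (@sub_finite_set _ _ [set` [:: g1; g2]]); last exact: finite_seq.
move=> g _ /=; rewrite !inE.
have [//|/eqP n1] := eqVneq g g1; have [//|/eqP n2] := eqVneq g g2.
by case: H; exists g.
Qed.

Lemma nonzero_sum (I : finType) (A : {set I}) (s : Gamma) :
  infinite_set [set: Gamma]%classic ->
  (#|A| = 0 -> s = 0%R) -> (#|A| = 1 -> s <> 0%R) ->
  exists2 f : I -> Gamma, forall i, f i <> 0%R & (\sum_(i in A) f i = s)%R.
Proof.
move=> Ginf; move E: #|A| => n; elim: n A s E => [|n IHn] A s cA s0 s1.
  have [g g0 _] := infinite_avoid2 0%R 0%R Ginf.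
  exists (fun=> g) => //; rewrite s0// big_pred0// => i.
  by rewrite (cards0_eq cA) inE.
have [x xA] : exists x, x \in A by apply/card_gt0P; rewrite cA.
have cA' : #|A :\ x| = n by move: cA; rewrite (cardsD1 x) xA => -[].
(* The label [g] of [x] must be [s] if no other point remains. Otherwise it is chosen outside [0]
   and [s], which leaves a nonzero sum, as a single remaining point requires. *)
have [g [g0 gs0 gs1]] :
    exists g, [/\ g <> 0%R, n = 0 -> (s - g = 0)%R & n = 1 -> (s - g <> 0)%R].
  case: n s1 {IHn cA cA' s0} => [/(_ erefl) sn0|n _].
    by exists s; split=> //; rewrite subrr.
  have [g g0 gs] := infinite_avoid2 0%R s Ginf.
  by exists g; split=> // _ /eqP; rewrite subr_eq0 => /eqP/esym.
have [f f0 fs] := IHn _ _ cA' gs0 gs1.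
exists (fun i => if i == x then g else f i) => [i|]; first by case: ifP.
rewrite (big_setD1 x)//= eqxx.
under eq_bigr => i /setD1P[/negPf -> _] do [].
by rewrite fs addrC subrK.
Qed.

End Multiples.

(** * Pendant vertices and the extension of a labeling to them *)

Section Pendants.
Variable G : sgraph.
Implicit Types u v : G.

Lemma in_nbh u v : (u \in nbh v) = adj v u.
Proof. by rewrite inE. Qed.

Lemma pendant_nbhE u v : u \in pendants G -> adj u v -> nbh u = [set v].
Proof.
rewrite inE => /cards1P[w nuE] uv; move: uv (nuE).
by rewrite -in_nbh nuE inE => /eqP ->.
Qed.

Lemma in_pendant_nbh u v :
  (u \in pendant_nbh v) = adj v u && (u \in pendants G).
Proof. by rewrite finset.in_setI in_nbh. Qed.

Lemma supportP v :
  reflect (exists2 u, u \in pendants G & adj v u) (v \in supports G).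
Proof.
rewrite inE; apply: (iffP idP) => [/card_gt0P[u]|[u up vu]].
  by rewrite in_pendant_nbh => /andP[vu up]; exists u.
by apply/card_gt0P; exists u; rewrite in_pendant_nbh vu.
Qed.

Lemma supports_cover v :
  (v \in supports G) = (v \in strong_supports G) || (v \in weak_supports G).
Proof. by rewrite !inE; case: #|_| => [|[|]]. Qed.

Variable Gamma : zmodType.

Lemma sum_nbhE v (l : G -> Gamma) :
  (\sum_(u in nbh v) l u =
   \sum_(u in pendant_nbh v) l u + \sum_(u in nbh v :\: pendants G) l u)%R.
Proof. by rewrite (big_setID (pendants G)). Qed.

Lemma magic_support (l : G -> Gamma) mu :
  (forall v, (\sum_(u in nbh v) l u)%R = mu) ->
  forall v, v \in supports G -> l v = mu.
Proof.
move=> lmu v /supportP[u up vu]; rewrite -(lmu u).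
by rewrite (pendant_nbhE up (v := v)) 1?adj_sym// big_set1.
Qed.

(* A labeling [base] of the nonpendant vertices, equal to [mu] on the supports,
   extends to the pendant ones as soon as the missing weight at each nonpendant
   vertex is a sum of nonzero labels of its pendant neighbors: by [nonzero_sum],
   only the empty sum and the sums of one term are constrained. *)
Lemma vertex_magic_extension (base : G -> Gamma) (mu : Gamma) :
  infinite_set [set: Gamma]%classic ->
  (forall u v, adj u v -> u \in pendants G -> v \notin pendants G) ->
  (forall v, v \notin pendants G -> base v <> 0%R) ->
  (forall v, v \in supports G -> base v = mu) ->
  (forall v, v \notin pendants G -> #|pendant_nbh v| = 0 ->
     (\sum_(u in nbh v :\: pendants G) base u = mu)%R) ->
  (forall v, v \notin pendants G -> #|pendant_nbh v| = 1 ->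
     (\sum_(u in nbh v :\: pendants G) base u <> mu)%R) ->
  vertex_magic Gamma G.
Proof.
move=> Ginf pendN base0 basemu h0 h1.
pose s v := (mu - \sum_(u in nbh v :\: pendants G) base u)%R.
have /choice[f fP] : forall v, exists f : G -> Gamma, v \notin pendants G ->
    (forall u, f u <> 0%R) /\ (\sum_(u in pendant_nbh v) f u = s v)%R.
  move=> v; have [vp|vp] := boolP (v \in pendants G); first by exists (fun=> 0%R).
  have [|||f f0 fs] := @nonzero_sum Gamma G (pendant_nbh v) (s v) => //.
  - by move=> c0; rewrite /s h0// subrr.
  - by move=> c1 /eqP; rewrite subr_eq0 eq_sym => /eqP; apply: h1.
  by exists f.
(* A pendant [u] has a single neighbor [nb u], so the choices [f v] made around distinct [v] never
   compete for its label. The default value is not reached for such [u]. *)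
pose nb u := odflt u [pick v | adj u v].
have nbE u v : u \in pendants G -> adj u v -> nb u = v.
  move=> up uv; rewrite /nb; case: pickP => [w|/(_ v)]; last by rewrite uv.
  by rewrite -in_nbh (pendant_nbhE up uv) inE => /eqP ->.
pose l u := if u \in pendants G then f (nb u) u else base u.
have pendE u : u \in pendants G -> exists2 v, adj u v & nbh u = [set v].
  rewrite inE => /cards1P[v nuE]; exists v => //.
  by rewrite -in_nbh nuE inE.
exists l; split=> [u|].
  rewrite /l; case: ifPn => [up|/base0//].
  have [v uv _] := pendE u up; rewrite (nbE _ _ up uv).
  by have [] := fP v (pendN _ _ uv up).
exists mu => v; have [vp|vp] := boolP (v \in pendants G).
  have [w vw ->] := pendE v vp; rewrite big_set1 /l (negPf (pendN _ _ vw vp)).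
  by apply: basemu; apply/supportP; exists v; rewrite // adj_sym.
rewrite sum_nbhE.
have -> : (\sum_(u in pendant_nbh v) l u = s v)%R.
  have [_ <-] := fP v vp; apply: eq_bigr => u.
  rewrite in_pendant_nbh => /andP[vu up].
  by rewrite /l up (nbE u v)// adj_sym.
rewrite [X in (_ + X)%R](_ : _ = \sum_(u in nbh v :\: pendants G) base u)%R.
  by rewrite /s subrK.
by apply: eq_bigr => u /setDP[_ /negPf]; rewrite /l => ->.
Qed.

End Pendants.

(** * Paths and distances in acyclic graphs *)

Section Acyclic.
Variable G : sgraph.
Hypothesis G_acyclic : acyclic_graph G.
Implicit Types (u v x y : G) (p q : seq G).

(** Otherwise the path, made simple and closed up through [x], would be a cycle of length at least
    3. *)
Lemma acyclic_detour x u v p : adj x u -> adj x v ->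
  path (@adj G) u p -> last u p = v -> x \notin u :: p -> u = v.
Proof.
move=> xu xv up; case: (shortenP up) => q uq q_uniq qp lastq xp.
have xq : x \notin u :: q.
  by apply: contra xp; rewrite !inE => /orP[->//|/qp ->]; rewrite orbT.
case: q => [//|w q] in uq q_uniq lastq xq {qp} *.
have /negP[] := @G_acyclic [:: x, u, w & q] isT.
rewrite /ucycleb [cycle _ _]/= rcons_path xu.
rewrite [uniq _]/= -/(uniq (u :: w :: q)) xq q_uniq !andbT.
rewrite [last _ _]/= in lastq *; rewrite lastq (adj_sym v) xv andbT.
by move: uq => /= /andP[-> ->].
Qed.

Lemma acyclic_triangle x y z : adj x y -> adj y z -> ~~ adj x z.
Proof.
move=> xy yz; apply/negP => xz.
have := @acyclic_detour x y z [:: z] xy xz.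
rewrite /= yz !inE; have [xE|_] := eqVneq x y; first by rewrite xE adj_irrefl in xy.
have [xE|_] := eqVneq x z; first by rewrite xE adj_irrefl in xz.
by move=> /(_ isT erefl isT) yE; rewrite yE adj_irrefl in yz.
Qed.

Lemma simple_path_unique x p q :
  simple_path x p -> simple_path x q -> last x p = last x q -> p = q.
Proof.
elim: p x q => [|u p IHp] x [|v q] //.
- move=> _ /andP[_ /= /andP[xq _]] xE.
  by rewrite [X in X \notin _]xE mem_last in xq.
- move=> /andP[_ /= /andP[xq _]] _ xE.
  by rewrite -[X in X \notin _]xE mem_last in xq.
move=> /andP[/= /andP[xu up] /andP[xp p_uniq]].
move=> /andP[/= /andP[xv vq] /andP[xq q_uniq]] lastE.
have uv : u = v.
  (* The detour follows the first path to the common end, then returns along the second one; neither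
     meets [x] again. *)
  apply: (acyclic_detour xu xv (p := p ++ rev (belast v q))).
  - rewrite cat_path up lastE rev_path.
    by rewrite (eq_path (e' := @adj G))// => y z; rewrite adj_sym.
  - rewrite last_cat lastE; case: (q) => [//|w q'].
    by rewrite /= rev_cons last_rcons.
  rewrite -cat_cons mem_cat (negPf xp) mem_rev.
  by apply: contra xq => /mem_belast.
rewrite uv in up p_uniq lastE *; congr cons; apply: (IHp v) => //.
- by rewrite /simple_path up.
- by rewrite /simple_path vq.
Qed.

(** If [u] were already on the path, the segment from [h] to [u] would be a detour between two
    distinct neighbors of [x]. *)
Lemma simple_path_extend x u h p : simple_path x (h :: p) ->
  adj u x -> u != h -> simple_path u (x :: h :: p).
Proof.
move=> /[dup] /andP[/= /andP[xh hp] /andP[xp _]].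
move=> /andP[xhp xhp_uniq] ux uh; rewrite /simple_path /= ux.
move: xhp xhp_uniq => /= -> ->; rewrite !andbT !inE.
have /negPf -> : u != x by apply: contraTneq ux => ->; rewrite adj_irrefl.
rewrite (negPf uh) /=; apply/negP => up; case/splitPr: up => p1 p2 in hp xp.
case/eqP: uh; apply/esym.
apply: (acyclic_detour xh _ (p := rcons p1 u)); first by rewrite adj_sym.
- by move: hp; rewrite cat_path rcons_path => /andP[-> /= /andP[-> _]].
- by rewrite last_rcons.
apply: contra xp; rewrite !inE mem_cat mem_rcons !inE.
by case/or3P=> ->; rewrite ?orbT.
Qed.

(** A walk that realizes the distance shortens to a simple path, which is [p] by uniqueness. The
    bound [size p < #|G|] covers the junk value of [dist]. *)
Lemma simple_path_dist x p : simple_path x p -> size p <= dist x (last x p).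
Proof.
move=> sp; have sizep : size p < #|G|.
  have /andP[_ /card_uniqP sizeE] := sp.
  by rewrite -[_ < _]/(size (x :: p) <= _) -sizeE max_card.
have [lt_d|] := ltnP (dist x (last x p)) #|G|; last by apply: leq_trans (ltnW _).
have : has (walk_length x (last x p)) (iota 0 #|G|) by rewrite has_find size_iota.
move=> /(nth_find 0); rewrite -/(dist _ _) nth_iota// add0n.
case/existsP=> q /andP[xq /eqP lastq].
move: lastq; case: (shortenP xq) => r xr r_uniq rq lastr.
have pr : p = r by apply: (simple_path_unique sp) => //; rewrite /simple_path xr.
by rewrite -(size_tuple q) {1}pr; move: r_uniq => /= /andP[_ /uniq_leq_size]; apply.
Qed.

End Acyclic.

Lemma simple_path_le_diameter (G : sgraph) (x : G) p :
  acyclic_graph G -> simple_path x p -> size p <= diameter G.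
Proof.
move=> G_acyclic /(simple_path_dist G_acyclic)/leq_trans; apply.
by apply: leq_trans (leq_bigmax x); apply: leq_bigmax.
Qed.

Lemma longest_path_diameter (G : sgraph) : is_tree G -> 0 < diameter G ->
  exists x, exists2 p : seq G, longest_path x p & size p = diameter G.
Proof.
(* A graph without vertices has diameter [0]; a vertex is needed for the maxima to be attained. *)
move=> [G_conn G_acyclic] diam0; have x0 : G.
  case: (pickP (@predT G)) => [//|noG]; move: diam0.
  by rewrite /diameter big_pred0.
have [|x Ex] := @eq_bigmax G (fun x => \max_(y : G) dist x y).
  by apply/card_gt0P; exists x0.
have [|y Ey] := @eq_bigmax G (dist x); first by apply/card_gt0P; exists x0.
have /connectP[q xq yE] := G_conn x y.
move: yE; case: (shortenP xq) => p xp p_uniq _ yE.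
have sp : simple_path x p by rewrite /simple_path xp.
have sizep : size p = diameter G.
  apply/eqP; rewrite eqn_leq (simple_path_le_diameter G_acyclic sp) /= /diameter Ex Ey.
  rewrite leqNgt; apply/negP => lt_p.
  have sizep : size p < #|G|.
    by rewrite -[_ < _]/(size (x :: p) <= _) -(card_uniqP p_uniq) max_card.
  have := before_find 0 lt_p; rewrite nth_iota// add0n => /existsP[].
  by exists (in_tuple p); rewrite xp -yE eqxx.
exists x, p => //; split=> // z r zr; rewrite sizep.
exact: simple_path_le_diameter G_acyclic zr.
Qed.

(** * Structure of the trees of diameter 4 around the central vertex *)

Section Diameter4.
Variables (T : sgraph) (vc : T).
Hypotheses (T_tree : is_tree T) (T_diam : diameter T = 4).
Hypothesis vc_central : central_vertex vc.
Implicit Types u v x : T.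

Let T_acyclic : acyclic_graph T := T_tree.2.

(** These are the two halves of a longest path. Having two branches of length 2 ensures that any
    path from [vc] can be prolonged backwards along one of them. *)
Lemma central_branches : exists a b c d,
  [/\ b != c, [/\ adj a b, adj b vc & a != vc] & [/\ adj d c, adj c vc & d != vc]].
Proof.
have [|a [p lp]] := longest_path_diameter T_tree; first by rewrite T_diam.
rewrite T_diam; case: p lp => [|b [|v [|c [|d [|]]]]]// lp _.
have <- : v = vc by rewrite -(vc_central lp).
have [/andP[/= /and5P[ab bv vc' cd _] p_uniq] _] := lp.
exists a, b, c, d; move: p_uniq; rewrite /= !inE !negb_or -!andbA.
move=> /and5P[_ av _ _ /and5P[_ bc _ _ /andP[vd _]]]; split=> //; split=> //.
- by rewrite adj_sym.
- by rewrite adj_sym.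
- by rewrite eq_sym.
Qed.

(** The first step [h] differs from [b] or from [c]. Prolonging the path by the corresponding branch
    adds 2 to its length, which cannot exceed 4. *)
Lemma simple_path_central p : simple_path vc p -> size p <= 2.
Proof.
case: p => [//|h p] sp; have [a [b [c [d [bc [ab bv av] [dc cv dv]]]]]] := central_branches.
have ext e f : adj e f -> adj f vc -> e != vc -> f != h -> size (h :: p) <= 2.
  move=> ef fv ev fh; have := simple_path_extend T_acyclic sp fv fh.
  move=> /(simple_path_extend T_acyclic)/(_ ef ev).
  by move=> /(simple_path_le_diameter T_acyclic); rewrite T_diam.
have [bh|] := eqVneq b h; last exact: ext ab bv av.
by apply: (ext _ _ dc cv dv); rewrite eq_sym -bh.
Qed.

Lemma deg_central : 1 < deg vc.
Proof.
have [a [b [c [d [bc [_ bv _] [_ cv _]]]]]] := central_branches.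
rewrite /deg (cardsD1 b) (cardsD1 c) !inE adj_sym bv eq_sym bc.
by rewrite adj_sym cv.
Qed.

Lemma central_nonpendant : vc \notin pendants T.
Proof. by rewrite inE; apply: contraTneq deg_central => ->. Qed.

(** A further neighbor [w] of [v] would give the path [vc], [x], [v], [w] of length 3; [w = vc] is
    excluded, since it would form a triangle. *)
Lemma pendant_nbh_central_nbr x v :
  adj vc x -> adj x v -> v != vc -> nbh v = [set x].
Proof.
move=> cx xv vNc; apply/setP => w; rewrite in_nbh inE; apply/idP/eqP => [vw|->].
  apply: contrapT => /eqP wx.
  suff /simple_path_central : simple_path vc [:: x; v; w] by [].
  have nadj (y z : T) : adj y z -> (y == z) = false.
    by move=> yz; apply/negP => /eqP yE; rewrite yE adj_irrefl in yz.
  rewrite /simple_path /= cx xv vw !inE (nadj _ _ cx) (nadj _ _ xv) (nadj _ _ vw).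
  rewrite eq_sym (negPf vNc) [x == w]eq_sym (negPf wx) !andbT /=.
  apply: contraTneq vw => <-; rewrite adj_sym.
  exact: acyclic_triangle cx xv.
by rewrite adj_sym.
Qed.

Lemma central_nbr_pendants x : adj vc x -> nbh x :\: pendants T = [set vc].
Proof.
move=> cx; apply/setP => v; rewrite finset.in_setD in_nbh finset.in_set1.
have [->|vNc] := eqVneq v vc; first by rewrite central_nonpendant adj_sym.
apply/negP => /andP[+ xv]; rewrite inE /deg.
by rewrite (pendant_nbh_central_nbr cx xv vNc) cards1.
Qed.

Lemma central_cover v : [\/ v = vc, adj vc v |
  exists x, [/\ adj vc x, adj x v & v != vc]].
Proof.
have /connectP[q cq vE] := T_tree.1 vc v.
move: vE; case: (shortenP cq) => p cp p_uniq _ vE.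
have /simple_path_central : simple_path vc p by rewrite /simple_path cp.
case: p cp p_uniq vE => [|x [|y [|]]]//= cp p_uniq -> _.
- exact: Or31.
- by apply: Or32; move: cp => /andP[].
apply: Or33; exists x; move: cp p_uniq => /and3P[-> -> _]; split=> //.
by move: p_uniq; rewrite !inE negb_or => /and3P[/andP[_]]; rewrite eq_sym.
Qed.

Lemma nonpendant_adj_central v :
  v != vc -> v \notin pendants T -> adj vc v.
Proof.
move=> vNc; have [vE|//|[x [cx xv _]]] := central_cover v.
  by rewrite vE eqxx in vNc.
by rewrite inE /deg (pendant_nbh_central_nbr cx xv vNc) cards1.
Qed.

Lemma nonpendant_support v :
  v != vc -> v \notin pendants T -> v \in supports T.
Proof.
move=> vNc vNp; have cv := nonpendant_adj_central vNc vNp.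
(* The only nonpendant neighbor of [v] is [vc], hence [deg v] is one more than the number of pendant
   neighbors, and it exceeds 1. *)
rewrite inE -(ltn_add2r 1) -[X in _ < _ + X](cards1 vc) -(central_nbr_pendants cv).
rewrite cardsID ltn_neqAle eq_sym; move: vNp; rewrite inE => -> /=.
by apply/card_gt0P; exists vc; rewrite in_nbh adj_sym.
Qed.

(** The neighbor of a pendant [u] is [vc], of degree at least 2, or a vertex [x] adjacent to both
    [vc] and [u]. *)
Lemma pendants_nonadjacent u v :
  adj u v -> u \in pendants T -> v \notin pendants T.
Proof.
move=> uv up; have nuE := pendant_nbhE up uv.
have [uE|cu|[x [cx xu uNc]]] := central_cover u.
- by rewrite uE (negPf central_nonpendant) in up.
- suff -> : v = vc by exact: central_nonpendant.
  by apply/esym/eqP; rewrite -finset.in_set1 -nuE in_nbh adj_sym.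
have xv : x = v by apply/eqP; rewrite -finset.in_set1 -nuE in_nbh adj_sym.
apply/negP => /(pendant_nbhE (v := vc)); rewrite -xv adj_sym => /(_ cx) nxE.
by move: xu; rewrite -in_nbh nxE inE (negPf uNc).
Qed.

End Diameter4.

Theorem theorem4p1 (Gamma : zmodType) (T : sgraph) (vc : T)
  (Gamma_infinite : infinite_set [set: Gamma]%classic)
  (Gamma_torsion : torsion Gamma)
  (T_tree : is_tree T)
  (T_diam : diameter T = 4)
  (vc_central : central_vertex vc) :
  vertex_magic Gamma T <->
  [\/ forall v : T, v \notin pendants T -> v \in strong_supports T,
      [/\ vc \in weak_supports T,
          ~ eqmod_exponent Gamma (deg vc) 2 &
          forall v : T, v != vc -> v \notin pendants T ->
            v \in strong_supports T]
    | vc \in neutrals T /\ gcd_exponent Gamma (deg vc - 1) <> 1].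
Proof.
have degc := deg_central T_tree T_diam vc_central.
have deg0 : 0 < deg vc - 1 by rewrite subn_gt0.
have cNp := central_nonpendant T_tree T_diam vc_central.
have adjc := nonpendant_adj_central T_tree T_diam vc_central.
have suppT := nonpendant_support T_tree T_diam vc_central.
have pendNadj := pendants_nonadjacent T_tree T_diam vc_central.
have nbhD := central_nbr_pendants T_tree T_diam vc_central.
have supN v : v \in supports T -> v \notin pendants T.
  by move=> /supportP[u up vu]; apply: pendNadj up; rewrite adj_sym.
have nbhcN u : u \in nbh vc :\: pendants T -> u \in supports T.
  rewrite finset.in_setD in_nbh => /andP[uNp cu]; apply: suppT => //.
  by apply: contraTneq cu => ->; rewrite adj_irrefl.
have cardc : deg vc = #|pendant_nbh vc| + #|nbh vc :\: pendants T|.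
  by rewrite /deg -(cardsID (pendants T)).
split.
  move=> [l [l0 [mu lmu]]]; have lsupp := magic_support lmu.
  have sumc : (\sum_(u in nbh vc :\: pendants T) l u =
               mu *+ #|nbh vc :\: pendants T|)%R.
    by rewrite -sumr_const; apply: eq_bigr => u /nbhcN/lsupp.
  (* [mu] is the label of some support: a neighbor of [vc] either is pendant, which makes [vc] a
     support, or is itself a support. *)
  have mu0 : mu <> 0%R.
    have /card_gt0P[u] : 0 < deg vc by apply: ltnW.
    rewrite in_nbh => cu; have [up|uNp] := boolP (u \in pendants T).
      by rewrite -(lsupp vc)//; apply/supportP; exists u.
    by rewrite -(lsupp u)//; apply: nbhcN; rewrite finset.in_setD uNp in_nbh.
  have := lmu vc; rewrite sum_nbhE sumc => wc.
  have [cs|cNs] := boolP (vc \in supports T); last first.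
    apply: Or33; split; first by rewrite !inE negb_or; move: cNp cNs; rewrite !inE => -> ->.
    apply/(gcd_exponent_neq1P _ deg0); exists mu => //.
    have pend0 : #|pendant_nbh vc| = 0.
      by apply/eqP; rewrite -leqn0 leqNgt; move: cNs; rewrite inE.
    move: wc; rewrite (cards0_eq pend0) big_set0 add0r => wc.
    by rewrite mulrnBr 1?ltnW// cardc pend0 wc subrr.
  have strong v : v != vc -> v \notin pendants T -> v \in strong_supports T.
    move=> vNc vNp; have := suppT v vNc vNp; rewrite supports_cover.
    case/orP=> //; rewrite inE => /cards1P[u pE].
    have := lmu v; rewrite sum_nbhE pE big_set1 nbhD ?adjc// big_set1 (lsupp _ cs).
    by move=> /eqP; rewrite eq_sym -subr_eq subrr eq_sym => /eqP/l0.
  move: (cs); rewrite supports_cover => /orP[cstrong|cweak].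
    by constructor 1 => v vNp; have [->//|vNc] := eqVneq v vc; apply: strong.
  (* If [deg vc] and 2 had the same effect on [mu], the nonpendant neighbors of [vc] would already
     contribute [mu], forcing the label of its pendant neighbor to be [0]. *)
  apply: Or32; split=> // /eqmod_exponentP/(_ mu) mu2.
  move: cweak cardc; rewrite inE => /cards1P[y yE]; rewrite yE cards1 => degE.
  move: wc mu2; rewrite yE big_set1 degE mulrnDr => wc /addrI mu2.
  by apply: (l0 y); move: wc; rewrite mu2 => /eqP; rewrite eq_sym -subr_eq subrr eq_sym => /eqP.
have strong_no v k : v \in strong_supports T -> k <= 1 -> #|pendant_nbh v| <> k.
  by rewrite inE => + k1 vk; rewrite vk ltnNge k1.
case=> [strong|[cweak /eqmod_exponentP neq strong]|[cn]].
- have [mu mu0 _] := infinite_avoid2 0%R 0%R Gamma_infinite.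
  apply: (@vertex_magic_extension _ _ (fun=> mu) mu) => // v vNp.
  + by move/strong_no: (strong v vNp); move/(_ 0 isT).
  + by move/strong_no: (strong v vNp); move/(_ 1 isT).
(* For such a [mu], the weight missing at [vc] under the constant labeling is nonzero, so it can
   label the single pendant neighbor. *)
- have [mu muN] : exists mu : Gamma, (mu *+ deg vc <> mu *+ 2)%R by apply/existsNP.
  have mu0 : mu <> 0%R by move=> mu0; apply: muN; rewrite mu0 !mul0rn.
  have c1 : #|pendant_nbh vc| = 1 by move: cweak; rewrite inE => /eqP.
  apply: (@vertex_magic_extension _ _ (fun=> mu) mu) => // v vNp vk.
  + have [vE|vNc] := eqVneq v vc; first by move: vk; rewrite vE c1.
    by case: (strong_no v 0 (strong v vNc vNp)).
  + have [vE|vNc] := eqVneq v vc; last by case: (strong_no v 1 (strong v vNc vNp)).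
    rewrite vE sumr_const => wc; apply: muN.
    by rewrite cardc c1 mulrnDr wc.
have cNs : vc \notin supports T by move: cn; rewrite finset.in_setC finset.in_setU negb_or => /andP[].
have c0 : #|pendant_nbh vc| = 0.
  by apply/eqP; rewrite -leqn0 leqNgt; move: cNs; rewrite inE.
move=> /(gcd_exponent_neq1P _ deg0)[mu mu0 muE].
(* The label [t] of [vc] differs from [mu] so that the weight [mu - t] missing at a neighboring
   support is nonzero, in case that support is weak. *)
have [t t0 tmu] := infinite_avoid2 0%R mu Gamma_infinite.
pose base v := if v == vc then t else mu.
apply: (@vertex_magic_extension _ _ base mu) => //.
- by move=> v _; rewrite /base; case: ifP.
- by move=> v vs; rewrite /base; case: eqVneq vs => // -> ; rewrite (negPf cNs).
- move=> v vNp vk; have [vE|vNc] := eqVneq v vc; last first.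
    by have := suppT v vNc vNp; rewrite inE vk.
  rewrite vE (eq_bigr (fun=> mu)); last first.
    move=> u /nbhcN us; rewrite /base; case: eqVneq us => // ->.
    by rewrite (negPf cNs).
  (* All the neighbors of [vc] are supports, so its weight is [mu *+ deg vc], which equals [mu] by
     the choice of [mu]. *)
  rewrite sumr_const; move: muE.
  by rewrite mulrnBr 1?ltnW// cardc c0 add0n => /eqP; rewrite subr_eq0 => /eqP.
move=> v vNp vk; have [vE|vNc] := eqVneq v vc; first by move: vk; rewrite vE c0.
by rewrite nbhD ?adjc// big_set1 /base eqxx.
Qed.
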